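(* Let $(\mathcal{W},\sigma)$ be a maximal simplicial pair of dimension $d$. Let $v_1,\dots,v_d$ be the primitive elements of $\mathcal{W}$ situated on the edges of $\sigma$, once an ordering $\prec$ of these edges is chosen. Then there exists a unique basis $(e_1,\dots,e_d)$ of $\mathcal{W}$ such that the vectors $v_1,\dots,v_d$ can be written as $$v_1=e_1,\qquad v_j=-\alpha_{1,j}e_1-\alpha_{2,j}e_2-\cdots-\alpha_{j-1,j}e_{j-1}+\alpha_{j,j}e_j\quad(2\le j\le d),$$ with $0\le\alpha_{i,j}<\alpha_{j,j}$ for all $1\le i<j\le d$.
   Context: A pair $(\mathcal{W},\sigma)$ consists of a lattice $\mathcal{W}$ (free abelian group of finite rank) and a strictly convex finite rational polyhedral cone $\sigma\subset\mathcal{W}_{\mathbf{R}}=\mathcal{W}\otimes\mathbf{R}$. It is maximal of dimension $d$ if $\dim\sigma=\dim\mathcal{W}_{\mathbf{R}}=d$, and simplicial if $\sigma$ is a simplicial cone. Edges of $\sigma$ are its $1$-dimensional faces; each contains exactly one primitive element of $\mathcal{W}$. *)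

(* Defs.v *)
From HB Require Import structures.
From mathcomp Require Import all_boot all_order all_algebra.
From mathcomp Require Import boolp classical_sets reals.

Set Implicit Arguments.
Unset Strict Implicit.
Unset Printing Implicit Defensive.

Import Order.TTheory GRing.Theory Num.Theory.
Local Open Scope classical_set_scope.
Local Open Scope ring_scope.

(* A lattice is a [vectType int]: a Z-module isomorphic to some Z^n. *)

Definition primitive (W : vectType int) (w : W) : Prop :=
  forall (m : int) (w' : W), w = m *: w' -> m = 1 \/ m = -1.

(* [free] and [basis_of] are only available over fields. *)
Definition lattice_basis (W : vectType int) (n : nat) (e : {ffun 'I_n -> W}) :
    Prop :=
  forall w : W, exists! c : {ffun 'I_n -> int}, w = \sum_(i < n) c i *: e i.

(* [V], together with [iota : w |-> w (x) 1], is the tensor product of [W]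
   with [R]; it is specified by its universal property. *)
Definition scalar_extension (R : realType) (W : vectType int) (V : vectType R)
    (iota : {additive W -> V}) : Prop :=
  forall (U : lmodType R) (f : {additive W -> U}),
    exists g : {linear V -> U},
      (forall w, g (iota w) = f w) /\
      (forall g' : {linear V -> U}, (forall w, g' (iota w) = f w) -> g' =1 g).

Section Cones.
Variables (R : realType) (V : vectType R).
Implicit Types (sigma tau : set V) (X : seq V).

Definition cone_of X : set V :=
  [set x | exists a : 'I_(size X) -> R,
     (forall i, 0 <= a i) /\ x = \sum_(i < size X) a i *: X`_i].

Definition strictly_convex sigma : Prop :=
  forall x, sigma x -> sigma (- x) -> x = 0.

Definition simplicial sigma : Prop := exists2 X, free X & sigma = cone_of X.

Definition linear_span sigma (U : {vspace V}) : Prop :=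
  sigma `<=` [set` U] /\
  forall U' : {vspace V}, sigma `<=` [set` U'] -> (U <= U')%VS.

Definition cone_dim sigma (k : nat) : Prop :=
  exists2 U : {vspace V}, linear_span sigma U & \dim U = k.

Definition face sigma tau : Prop :=
  exists u : {scalar V},
    (forall x, sigma x -> 0 <= u x) /\ tau = [set x | sigma x /\ u x = 0].

Definition edge sigma tau : Prop := face sigma tau /\ cone_dim tau 1.

End Cones.

Section Pairs.
Variables (R : realType) (W : vectType int) (V : vectType R).
Variables (iota : {additive W -> V}) (sigma : set V).

Definition rational_polyhedral : Prop :=
  exists S : seq W, sigma = cone_of (map iota S).

Definition lattice_cone_pair : Prop :=
  [/\ scalar_extension iota, rational_polyhedral & strictly_convex sigma].

Definition maximal_pair (d : nat) : Prop :=
  cone_dim sigma d /\ \dim {:V} = d.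

(* An ordering of the edges is encoded as an enumeration [rho 0, rho 1, ...]
   without repetition; [v i] is the primitive element on [rho i]. *)
Definition ordered_edges (d : nat) (rho : 'I_d -> set V) : Prop :=
  injective rho /\ forall tau, edge sigma tau <-> exists i, tau = rho i.

Definition primitive_on_edges (d : nat) (rho : 'I_d -> set V) (v : 'I_d -> W) :
    Prop :=
  forall i, primitive (v i) /\ rho i (iota (v i)).

End Pairs.

(* Main.v *)
(** In coordinates of W, the vectors v_j are the rows of a square integer
    matrix M, and the required bases correspond to the factorisations M = L E
    with E unimodular and L in Hermite normal form, normalised so that the
    entries below the diagonal are nonpositive.  When det M <> 0 such a
    factorisation exists and is unique; primitivity of v_1 makes the first
    diagonal entry equal to 1.  The determinant is nonzero because the d
    generators of the simplicial cone span d distinct edges: these are all the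
    rho i, so the v_i are positive multiples of the generators, in some order,
    and remain independent over R. *)

Require Import Defs.
From HB Require Import structures.
From mathcomp Require Import all_boot all_order all_algebra zify.
From mathcomp Require Import boolp classical_sets reals.

Set Implicit Arguments.
Unset Strict Implicit.
Unset Printing Implicit Defensive.

Import Order.TTheory GRing.Theory Num.Theory VectorInternalTheory.
Local Open Scope classical_set_scope.
Local Open Scope ring_scope.

(** * Hermite normal form of integer matrices *)

Definition reduced_col n (L : 'M[int]_n) (c : 'cV[int]_n) : Prop :=
  forall i, - L i i < c i 0 <= 0.

Definition hermite n (L : 'M[int]_n) : Prop :=
  [/\ forall i j : 'I_n, (i < j)%N -> L i j = 0,
      forall i, 0 < L i i
    & forall i j : 'I_n, (j < i)%N -> - L i i < L i j <= 0].

(** Each bound refers to the diagonal entry of its own row, so the first column is bounded by the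
    diagonal of [L], not by [a]. Peeling off this column drives the inductions on the size. *)
Lemma hermite_block n (a : 'M[int]_1) c (L : 'M[int]_n) :
  hermite (block_mx a 0 c L) <-> [/\ 0 < a 0 0, reduced_col L c & hermite L].
Proof.
split=> [[Lu Ld Lr]|[a0 cr [Lu Ld Lr]]].
  split; first by have := Ld (lshift n 0); rewrite block_mxEul.
    move=> i; have := Lr (rshift 1 i) (lshift n 0) isT.
    by rewrite block_mxEdl block_mxEdr.
  split=> [i j lij|i|i j lij].
  - by have := Lu (rshift 1 i) (rshift 1 j); rewrite block_mxEdr; apply.
  - by have := Ld (rshift 1 i); rewrite block_mxEdr.
  - by have := Lr (rshift 1 i) (rshift 1 j); rewrite !block_mxEdr; apply.
split=> [i j|i|i j].
- case: (split_ordP i) => i' ->; case: (split_ordP j) => j' -> lij.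
  + by move: lij; rewrite !ord1.
  + by rewrite block_mxEur mxE.
  + by move: lij; rewrite /= [j']ord1.
  + by rewrite block_mxEdr Lu.
- by case: (split_ordP i) => i' ->; rewrite ?block_mxEul ?block_mxEdr ?ord1.
- case: (split_ordP i) => i' ->; case: (split_ordP j) => j' -> lij.
  + by move: lij; rewrite !ord1.
  + by move: lij; rewrite /= [i']ord1.
  + by rewrite block_mxEdr block_mxEdl [j']ord1; apply: cr.
  + by rewrite !block_mxEdr; apply: Lr.
Qed.

Lemma hermite_blockP n (L : 'M[int]_(1 + n)) : hermite L ->
  exists (a : 'M[int]_1) (c : 'cV[int]_n) (L' : 'M[int]_n),
    [/\ L = block_mx a 0 c L', 0 < a 0 0, reduced_col L' c
    & hermite L'].
Proof.
move=> hL; exists (ulsubmx L), (dlsubmx L), (drsubmx L).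
have e : L = block_mx (ulsubmx L) 0 (dlsubmx L) (drsubmx L).
  rewrite -[LHS]submxK; congr block_mx.
  apply/matrixP=> i j; rewrite !mxE; case: hL => + _ _; apply.
  by rewrite [i]ord1.
by split=> //; move: hL; rewrite {1}e => /hermite_block[].
Qed.

(** The middle term is minus the remainder of [- c] by [a]; dividing [- c] rather than [c] gives it
    the right sign. *)
Lemma addz_divz_bounds (a c : int) :
  0 < a -> - a < c + divz (- c) a * a <= 0.
Proof.
move=> a0; have := divz_eq (- c) a.
have := modz_ge0 (- c) (lt0r_neq0 a0); have := ltz_pmod (- c) a0.
by move: (divz _ _) (modz _ _) => q m; lia.
Qed.

(** Entries are reduced from the top down: by triangularity the later entries of [x] leave the
    earlier ones alone, and the effect of [q] on the lower entries is absorbed in the column passed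
    to the induction. *)
Lemma hermite_reduce n (L : 'M[int]_n) (c : 'cV[int]_n) :
  hermite L -> exists x, reduced_col L (c + L *m x).
Proof.
elim: n L c => [|n IHn] L c; first by exists 0 => -[].
rewrite -[n.+1]/(1 + n)%N in L c *.
move=> /hermite_blockP[a [b [M [-> a0 _ hM]]]].
pose q := divz (- usubmx c 0 0) (a 0 0).
have [x xr] := IHn M (dsubmx c + b *m q%:M) hM.
exists (col_mx q%:M x).
rewrite -[c]vsubmxK mul_block_col mul0mx addr0 add_col_mx addrA.
move=> i; case: (split_ordP i) => i' ->; last first.
  by rewrite block_mxEdr col_mxEd; apply: xr.
rewrite block_mxEul col_mxEu ord1 mul_mx_scalar !mxE /q.
rewrite !mxE.
exact: addz_divz_bounds.
Qed.

(** The top entries of both columns lie in a half-open interval of length [a 0 0] and differ by a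
    multiple of it, hence agree; the rest is induction. *)
Lemma hermite_reduce_uniq n (L : 'M[int]_n) (c x : 'cV[int]_n) :
  hermite L -> reduced_col L c -> reduced_col L (c + L *m x) -> x = 0.
Proof.
elim: n L c x => [|n IHn] L c x; first by move=> *; apply/matrixP=> -[].
rewrite -[n.+1]/(1 + n)%N in L c x *.
move=> /hermite_blockP[a [b [M [-> a0 _ hM]]]].
rewrite -[c]vsubmxK -[x]vsubmxK mul_block_col mul0mx addr0 add_col_mx => cr cxr.
have x0 : usubmx x = 0.
  apply/matrixP=> i j; rewrite !ord1 [RHS]mxE.
  have := cr (lshift n 0); have := cxr (lshift n 0).
  rewrite block_mxEul !col_mxEu [X in _ < X <= _]mxE [(a *m _) 0 0]mxE big_ord1.
  by move: (a 0 0) (usubmx c 0 0) (usubmx x 0 0) => *; nia.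
rewrite x0 [X in col_mx _ X](IHn M (dsubmx c)) ?col_mx0 // => i.
  by have := cr (rshift 1 i); rewrite block_mxEdr col_mxEd.
by have := cxr (rshift 1 i); rewrite block_mxEdr col_mxEd x0 mulmx0 add0r.
Qed.

(** The Smith form of a single row is zero beyond its first entry; inverting the right factor clears
    the row, and the sign [sg] makes [p] nonnegative. *)
Lemma unimodular_row n (r : 'rV[int]_(1 + n)) :
  exists2 U, U \in unitmx & exists2 a : 'M_1, 0 <= a 0 0 & r *m U = row_mx a 0.
Proof.
have [P uP [Q uQ [s _ eqr]]] := int_Smith_normal_form r.
set D := \matrix_(i, j) _ in eqr.
pose p := P 0 0 * s`_0; pose sg : int := if p < 0 then -1 else 1.
have usg : sg \is a GRing.unit by rewrite /sg; case: ifP.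
exists (sg *: invmx Q); first by rewrite unitmxZ // unitmx_inv.
exists (p * sg)%:M; first by rewrite mxE /= mulr1n /sg; case: ifP; lia.
rewrite -scalemxAr {1}eqr mulmxK //; apply/matrixP=> i j.
rewrite [LHS]mxE [X in _ * X]mxE big_ord1 [D _ _]mxE [i]ord1 /=.
case: (split_ordP j) => j' ->.
  by rewrite row_mxEl [j']ord1 mxE /= /p mulrC.
by rewrite row_mxEr mxE /= mulr0n !mulr0.
Qed.

Lemma hermite_exists n (M : 'M[int]_n) : \det M != 0 ->
  exists2 U, U \in unitmx & hermite (M *m U).
Proof.
elim: n M => [|n IHn] M; first by exists 1%:M; [exact: unitmx1 | split=> -[]].
rewrite -[n.+1]/(1 + n)%N in M * => dM.
have [U uU [a a0 eqMU]] := unimodular_row (usubmx M).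
pose B := dsubmx M *m U.
have eqM : M *m U = block_mx a 0 (lsubmx B) (rsubmx B).
  by rewrite -{1}[M]vsubmxK mul_col_mx eqMU /block_mx hsubmxK.
have : \det (M *m U) != 0.
  rewrite det_mulmx mulf_neq0 //; apply: contraTneq uU => dU0.
  by rewrite unitmxE dU0 unitr0.
rewrite eqM det_lblock mulf_eq0 negb_or det_mx11 => /andP[a_neq0 dB].
have [T uT hT] := IHn _ dB.
have [x xr] := hermite_reduce (lsubmx B) hT.
(* The block [T] puts the lower right block in Hermite form, and [T *m x] adds to the first column
   the combination that reduces it. *)
exists (U *m block_mx 1%:M 0 (T *m x) T).
  by rewrite unitmx_mul uU unitmxE det_lblock det1 mul1r -unitmxE.
rewrite mulmxA eqM mulmx_block !mulmx1 !mul0mx !mulmx0 !addr0 add0r mulmxA.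
by apply/hermite_block; split=> //; rewrite lt_neqAle eq_sym a_neq0.
Qed.

(** The zero block above the diagonal forces [u = 0], so induction applies to [T']. Positivity of
    both pivots excludes -1 for the unit [t], and [s] vanishes because [c] and [c + M *m s] are both
    reduced. *)
Lemma hermite_uniq n (L T : 'M[int]_n) :
  T \in unitmx -> hermite L -> hermite (L *m T) -> T = 1%:M.
Proof.
elim: n L T => [|n IHn] L T; first by move=> *; apply/matrixP=> -[].
rewrite -[n.+1]/(1 + n)%N in L T *.
move=> uT /hermite_blockP[a [c [M [-> a0 cr hM]]]].
move=> /[dup] hLT /hermite_blockP[a' [c' [M' [eqLT a'0 cr' hM']]]].
move: eqLT uT; rewrite -[T]submxK mulmx_block !mul0mx !addr0.
set t := ulsubmx T; set u := ursubmx T; set s := dlsubmx T; set T' := drsubmx T.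
move=> /eq_block_mx[eqa equ eqc eqM].
have u0 : u = 0.
  apply/matrixP=> i j; move/matrixP/(_ i j): equ.
  rewrite [LHS]mxE big_ord1 [RHS]mxE [i]ord1 => /eqP.
  by rewrite mulf_eq0 (gt_eqF a0) => /eqP ->; rewrite mxE.
move: eqc eqM; rewrite u0 mulmx0 add0r => eqc eqM.
rewrite unitmxE det_lblock unitrM => /andP[ut]; rewrite -unitmxE => uT'.
have T1 : T' = 1%:M by apply: (IHn M) => //; rewrite eqM.
have t1 : t = 1%:M.
  have : a 0 0 * t 0 0 = a' 0 0 by rewrite -eqa [RHS]mxE big_ord1.
  move=> at_eq; apply/matrixP=> i j; rewrite !ord1 [RHS]mxE /=.
  by move: ut; rewrite det_mx11 unfold_in /=; nia.
move: eqM; rewrite T1 mulmx1 => eqM.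
rewrite t1 (@hermite_reduce_uniq _ M c s) ?scalar_mx_block //.
by move: eqc; rewrite t1 mulmx1 => ->; rewrite eqM.
Qed.

(** * Edges of a simplicial cone *)

Section SimplicialCone.
Variables (R : realType) (V : vectType R) (X : seq V).
Hypothesis X_free : free X.

(** Freeness identifies the coefficients with [coord]; since [coord] is total, membership in the
    span is a separate condition. *)
Lemma mem_cone_of x :
  cone_of X x <-> x \in <<X>>%VS /\ forall i, 0 <= coord (in_tuple X) i x.
Proof.
split=> [[a [a0 ->]]|[xX x0]]; last first.
  by exists (coord (in_tuple X) ^~ x); split=> //;
    exact: (@coord_span _ _ _ (in_tuple X)).
split; last by move=> i; rewrite (coord_sum_free _ _ (X := in_tuple X)).
by apply: memv_suml => i _; rewrite memvZ // memv_span // mem_nth.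
Qed.

Lemma cone_of_nth (i : 'I_(size X)) a : 0 <= a -> cone_of X (a *: X`_i).
Proof.
move=> a0; apply/mem_cone_of; split.
  by rewrite memvZ // memv_span // mem_nth.
move=> j; rewrite linearZ /= (coord_free _ _ (X := in_tuple X)) //.
by rewrite mulr_ge0.
Qed.

Lemma cone_dim_cone_of k : cone_dim (cone_of X) k -> size X = k.
Proof.
move=> [U [sU minU] <-].
have -> : U = <<X>>%VS.
  apply/eqP; rewrite eqEsubv minU; last by move=> x /mem_cone_of[].
  apply/span_subvP => x /(nthP 0)[i iX <-].
  have := @cone_of_nth (Ordinal iX) 1 ler01; rewrite scale1r.
  exact: sU.
by rewrite (eqP X_free).
Qed.

Definition ray (l : 'I_(size X)) : set V :=
  [set x | exists2 a, 0 <= a & x = a *: X`_l].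

Lemma nth_free_neq0 (l : 'I_(size X)) : X`_l != 0.
Proof. by apply: (free_not0 X_free); rewrite mem_nth. Qed.

Lemma edge_ray l : edge (cone_of X) (ray l).
Proof.
split; last first.
  exists <[X`_l]>%VS; last by rewrite dim_vline nth_free_neq0.
  split=> [x [a _ ->]|U /(_ X`_l) Ul]; first by rewrite /= memvZ // memv_line.
  by apply: Ul; exists 1; rewrite ?scale1r.
(* Supporting form of the ray: on the cone it is nonnegative and vanishes exactly where all
   coordinates other than the [l]-th do. *)
pose u x := \sum_(i | i != l) coord (in_tuple X) i x.
have u_lin : scalar u.
  move=> a x y; rewrite /u mulr_sumr -big_split; apply: eq_bigr => i _.
  by rewrite linearP.
pose uL : {scalar V} := HB.pack u (GRing.isLinear.Build R V R *%R u u_lin).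
exists uL; split=> [x /mem_cone_of[_ x0]|]; first by rewrite /= /u sumr_ge0.
apply/seteqP; split=> x /=.
  move=> [a a0 ->]; split; first exact: cone_of_nth.
  rewrite /u big1 // => i il.
  rewrite linearZ /= (coord_free _ _ (X := in_tuple X)) //.
  by rewrite eq_sym (negPf il) mulr0.
move=> [/mem_cone_of[xX x0]] /eqP; rewrite psumr_eq0 //.
move=> /allP xl; exists (coord (in_tuple X) l x) => //.
rewrite {1}(@coord_span _ _ _ (in_tuple X) x xX) (bigD1 l) //= big1 ?addr0 //.
move=> i il; have := xl i (mem_index_enum _); rewrite il /= => /eqP ->.
by rewrite scale0r.
Qed.

Lemma ray_inj : injective ray.
Proof.
move=> l m lm; have : ray l X`_l by exists 1; rewrite ?scale1r.
rewrite lm => -[a _ eqlm].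
have := coord_free l l (X := in_tuple X) X_free.
rewrite eqlm linearZ /= (coord_free _ _ (X := in_tuple X)) //.
by case: (m =P l) => // _ /eqP; rewrite mulr0 eqxx eq_sym oner_eq0.
Qed.

(** Counting shows that every edge is a ray: the rays are distinct edges, as many as the [rho i], so
    [s] is a bijection. Each [p i] is then a nonzero multiple of its own generator. *)
Lemma free_edge_points (rho : 'I_(size X) -> set V) (p : 'I_(size X) -> V) :
    ordered_edges (cone_of X) rho -> (forall i, rho i (p i)) ->
    (forall i, p i != 0) ->
  free [tuple p i | i < size X].
Proof.
move=> [rho_inj rhoE] rho_p p0.
have [s sE] := boolp.choice (fun l => (rhoE (ray l)).1 (edge_ray l)).
have s_inj : injective s by move=> l m slm; apply: ray_inj; rewrite !sE slm.
have [t sK tK] := injF_bij s_inj.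
have /boolp.choice[a aE] i : exists a, p i = a *: X`_(t i).
  by have := rho_p i; rewrite -{1}(tK i) -sE => -[a _]; exists a.
apply/freeP => c; under eq_bigr do rewrite nth_mktuple aE scalerA.
rewrite (reindex_inj s_inj) /=; under eq_bigr do rewrite sK.
move=> /(freeP (X := in_tuple X) X_free) ca0 i.
have /eqP := ca0 (t i); rewrite tK mulf_eq0 => /orP[/eqP//|/eqP a0].
by have := p0 i; rewrite aE a0 scale0r eqxx.
Qed.

End SimplicialCone.

(** * The lattice inside its scalar extension *)

Lemma additive_scale_int (W : lmodType int) (R : nzRingType) (V : lmodType R)
    (f : {additive W -> V}) (m : int) w : f (m *: w) = m%:~R *: f w.
Proof. by rewrite -{1}[m]intz !scaler_int raddfMz. Qed.

Section ScalarExtension.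
Variables (R : realType) (W : vectType int) (V : vectType R).
Variables (iota : {additive W -> V}) (n : nat) (phi : {linear W -> 'rV[int]_n}).
Hypotheses (phi_bij : bijective phi) (iotaP : scalar_extension iota).

(* [h] sends the basis of R^n to the images of the basis of W; [h \o g] is the
   identity by the uniqueness part of the universal property. *)
Lemma scalar_extension_coord : exists2 g : {linear V -> 'rV[R]_n},
  bijective g & forall w, g (iota w) = map_mx intr (phi w).
Proof.
have [psi phiK psiK] := phi_bij.
have [g [gE _]] := iotaP (map_mx intr \o phi : {additive W -> 'rV[R]_n}).
pose h (r : 'rV[R]_n) : V := \sum_j r 0 j *: iota (psi (delta_mx 0 j)).
have h_lin : linear h.
  move=> a r r'; rewrite /h scaler_sumr -big_split; apply: eq_bigr => j _.
  by rewrite !mxE scalerDl scalerA.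
pose hL : {linear 'rV[R]_n -> V} :=
  HB.pack h (GRing.isLinear.Build R _ _ _ h h_lin).
have hg_iota w : h (g (iota w)) = iota w.
  rewrite gE /h; under eq_bigr do rewrite mxE -additive_scale_int.
  rewrite -raddf_sum; congr (iota _).
  apply: (bij_inj phi_bij); rewrite linear_sum [RHS]row_sum_delta.
  by apply: eq_bigr => j _; rewrite linearZ /= psiK.
have hgK : cancel g h.
  move=> x; have [k [_ k_uniq]] := iotaP iota.
  by rewrite -[LHS]/((hL \o g) x) k_uniq // -[x in RHS]/(idfun x) k_uniq.
exists g => //; exists h => // r.
rewrite /h linear_sum [RHS]row_sum_delta; apply: eq_bigr => j _.
by rewrite linearZ /= gE /= psiK map_delta_mx.
Qed.

(** This matches the rank of the lattice with the dimension of the cone. *)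
Lemma dim_scalar_extension : \dim {:V} = n.
Proof.
have [g [h gK hK] _] := scalar_extension_coord.
have gE : linfun g =1 g by move=> x; rewrite lfunE.
have ker_g : lker (linfun g) == 0%VS.
  by apply/lker0P => x y; rewrite !gE => /(can_inj gK).
rewrite -(limg_dim_eq (f := linfun g)) ?(eqP ker_g) ?capv0 //.
have -> : (linfun g @: fullv)%VS = fullv.
  apply/eqP; rewrite eqEsubv subvf; apply/subvP => r _.
  by rewrite -(hK r) -gE memv_img ?memvf.
by rewrite dimvf [LHS]mul1n.
Qed.

(** Up to the bijections [phi] and [g], [iota] is the entrywise inclusion of Z^n in R^n. *)
Lemma scalar_extension_eq0 w : iota w = 0 -> w = 0.
Proof.
have [g _ gE] := scalar_extension_coord.
move=> w0; apply: (bij_inj phi_bij); rewrite linear0.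
have := gE w; rewrite w0 linear0 => /matrixP phi0.
apply/matrixP=> i j; have /eqP := phi0 i j.
by rewrite !mxE eq_sym intr_eq0 => /eqP.
Qed.

End ScalarExtension.

(** * Lattice bases and their coordinate matrices *)

Lemma lattice_basis_unitmx (W : vectType int) n (phi : {linear W -> 'rV[int]_n})
    (e : {ffun 'I_n -> W}) : bijective phi ->
  lattice_basis e <-> \matrix_i phi (e i) \in unitmx.
Proof.
move=> phi_bij; have [psi phiK psiK] := phi_bij.
set E := \matrix_i _.
have phi_sum (c : {ffun 'I_n -> int}) :
    phi (\sum_i c i *: e i) = (\row_i c i) *m E.
  rewrite linear_sum mulmx_sum_row; apply: eq_bigr => i _.
  by rewrite linearZ /= rowK mxE.
split=> [eW|uE w].
  (* Expanding the standard vectors in [e] gives a left inverse of [E], which suffices for a square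
     matrix. *)
  have /boolp.choice[c cE] j : exists c : {ffun 'I_n -> int},
      'e_j = (\row_i c i) *m E.
    by have [c [wE _]] := eW (psi 'e_j); exists c; rewrite -phi_sum -wE psiK.
  suff /mulmx1_unit[] : (\matrix_j \row_i c j i) *m E = 1%:M by [].
  by apply/row_matrixP => j; rewrite row_mul rowK -cE row1.
exists [ffun i => (phi w *m invmx E) 0 i]; split.
  apply: (can_inj phiK); rewrite phi_sum.
  rewrite (_ : \row_i _ = phi w *m invmx E) ?mulmxKV //.
  by apply/rowP => i; rewrite mxE ffunE.
move=> c ->; apply/ffunP => i.
by rewrite ffunE phi_sum mulmxK // mxE.
Qed.

Lemma hermite_sum (W : vectType int) n (L : 'M[int]_n) (e : 'I_n -> W) j :
    (forall i j : 'I_n, (i < j)%N -> L i j = 0) ->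
  \sum_i L j i *: e i = \sum_(i < n | (i < j)%N) L j i *: e i + L j j *: e j.
Proof.
move=> Lu; rewrite (bigID (fun i : 'I_n => (i < j)%N)) /=; congr (_ + _).
rewrite (bigD1 j) ?ltnn //= big1 ?addr0 // => i /andP[ij i_neq_j].
by rewrite Lu ?scale0r // ltn_neqAle eq_sym i_neq_j leqNgt.
Qed.

(** Indices are transposed: row [j] of [L] holds the coefficients of [v j]. The first equation
    carries no coefficient; it corresponds to a diagonal entry 1 in [L], which primitivity of the
    first vector enforces. *)
Lemma alpha_hermite (W : vectType int) d (v e : 'I_d -> W) :
    (forall j, primitive (v j)) ->
  (exists alpha : 'I_d -> 'I_d -> int,
      [/\ forall i j : 'I_d, (i < j)%N -> 0 <= alpha i j < alpha j j,
          forall j : 'I_d, j = 0%N :> nat -> v j = e j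
        & forall j : 'I_d, (0 < j)%N ->
            v j = \sum_(i < d | (i < j)%N) (- alpha i j *: e i)
                  + alpha j j *: e j]) <->
  exists2 L : 'M_d, hermite L & forall j, v j = \sum_i L j i *: e i.
Proof.
move=> v_prim; split=> [[alpha [alpha_lt v0 vS]]|[L [Lu Ld Lr] vE]].
  pose L := \matrix_(j, i) if (i < j)%N then - alpha i j else
    if i == j then (if val j == 0%N then 1 else alpha j j) else 0.
  have Lii i : L i i = if val i == 0%N then 1 else alpha i i.
    by rewrite mxE ltnn eqxx.
  have Llt (i j : 'I_d) : (i < j)%N -> L j i = - alpha i j by rewrite mxE => ->.
  have Lu (i j : 'I_d) : (i < j)%N -> L i j = 0.
    by move=> ij; rewrite mxE ltnNge ltnW //= gt_eqF.
  exists L; first split=> // [i|i j ij].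
  - rewrite Lii; case: eqP => // /eqP; rewrite -lt0n => i0.
    (* Positivity of [alpha i i] is read off from its bound on the coefficient of index 0. *)
    have := alpha_lt (Ordinal (leq_ltn_trans (leq0n i) (ltn_ord i))) i i0.
    by case/andP; apply: le_lt_trans.
  - rewrite (Llt _ _ ij) Lii -leqn0 leqNgt (leq_ltn_trans _ ij) //=.
    by rewrite ltrN2 oppr_le0 andbC; apply: alpha_lt.
  move=> j; rewrite hermite_sum // Lii; case: (posnP j) => j0.
    by rewrite j0 scale1r big1 ?add0r ?v0 // => i; rewrite j0 ltn0.
  rewrite vS // /=; congr (_ + _); apply: eq_bigr => i ij.
  by rewrite Llt.
exists (fun i j => if i == j then L j j else - L j i).
split=> [i j ij|j j0|j j0].
- by rewrite lt_eqF // eqxx; have := Lr _ _ ij; lia.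
- have vj : v j = L j j *: e j.
    by rewrite vE hermite_sum // big1 ?add0r // => i; rewrite j0 ltn0.
  (* Primitivity leaves 1 or -1 for [L j j], and positivity of the diagonal rules out -1. *)
  have [Lj|Lj] := v_prim j _ _ vj; first by rewrite vj Lj scale1r.
  by have := Ld j; rewrite Lj.
- rewrite vE hermite_sum // eqxx; congr (_ + _).
  by apply: eq_bigr => i ij; rewrite lt_eqF // opprK.
Qed.

Lemma hermite_basis_exists_unique (W : vectType int) d
    (phi : {linear W -> 'rV[int]_d}) (v : 'I_d -> W) :
    bijective phi -> \det (\matrix_i phi (v i)) != 0 ->
  exists! e : {ffun 'I_d -> W}, lattice_basis e /\
    exists2 L : 'M_d, hermite L & forall j, v j = \sum_i L j i *: e i.
Proof.
move=> phi_bij; have [psi phiK psiK] := phi_bij.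
set M := \matrix_i _ => dM.
have vE (e : {ffun 'I_d -> W}) (L : 'M_d) :
  (forall j, v j = \sum_i L j i *: e i) <-> M = L *m \matrix_i phi (e i).
  have sumE j : phi (\sum_i L j i *: e i) = row j (L *m \matrix_i phi (e i)).
    rewrite row_mul mulmx_sum_row linear_sum; apply: eq_bigr => i _.
    by rewrite linearZ /= rowK mxE.
  split=> [ve|/row_matrixP ve j].
    by apply/row_matrixP => j; rewrite rowK ve sumE.
  by apply: (can_inj phiK); rewrite sumE -ve rowK.
have [U uU hMU] := hermite_exists dM.
(* Since [M] is [(M *m U) *m invmx U], the basis consists of the rows of [invmx U]. *)
pose e := [ffun i => psi (row i (invmx U))].
have eE : \matrix_i phi (e i) = invmx U.
  by apply/row_matrixP => i; rewrite rowK ffunE psiK.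
exists e; split.
  split; first by apply/(lattice_basis_unitmx _ phi_bij); rewrite eE unitmx_inv.
  by exists (M *m U) => //; apply/vE; rewrite eE mulmxK.
move=> e' [/(lattice_basis_unitmx _ phi_bij) uE' [L hL /vE eqM]].
set E' := \matrix_i _ in uE' eqM.
(* Both [L] and [L *m (E' *m U)], which equals [M *m U], are Hermite. *)
have E'U : E' *m U = 1%:M.
  apply: (hermite_uniq _ hL); first by rewrite unitmx_mul uE'.
  by rewrite mulmxA -eqM.
have eqE : \matrix_i phi (e i) = E'.
  by rewrite eE -[LHS]mul1mx -E'U mulmxK.
apply/ffunP => i; apply: (can_inj phiK).
by have := congr1 (row i) eqE; rewrite !rowK.
Qed.

Theorem proposition4p7 (R : realType) (W : vectType int) (V : vectType R)
    (iota : {additive W -> V}) (sigma : set V) (d : nat)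
    (Hpair : lattice_cone_pair iota sigma)
    (Hmax : maximal_pair sigma d)
    (Hsimp : simplicial sigma)
    (rho : 'I_d -> set V) (Hrho : ordered_edges sigma rho)
    (v : 'I_d -> W) (Hv : primitive_on_edges iota rho v) :
  exists! e : {ffun 'I_d -> W},
    lattice_basis e /\
    exists alpha : 'I_d -> 'I_d -> int,
      [/\ forall i j : 'I_d, (i < j)%N -> 0 <= alpha i j < alpha j j,
          forall j : 'I_d, j = 0%N :> nat -> v j = e j
        & forall j : 'I_d, (0 < j)%N ->
            v j = \sum_(i < d | (i < j)%N) (- alpha i j *: e i)
                  + alpha j j *: e j].
Proof.
have [iotaP _ _] := Hpair; have [dim_sigma dimV] := Hmax.
have [X X_free sigmaE] := Hsimp.
have v_prim j : primitive (v j) by have [] := Hv j.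
have [phi phi_bij] : exists phi : {linear W -> 'rV[int]_d}, bijective phi.
  (* Coordinates come with the rank [dim W]; it equals [d] because both are the dimension of [V]. *)
  have [phi phi_bij] :
      exists phi : {linear W -> 'rV[int]_(dim W)}, bijective phi.
    exists v2r.
    by exists r2v; [exact: v2rK | exact: r2vK].
  by rewrite -dimV (dim_scalar_extension phi_bij iotaP); exists phi.
have iota_neq0 j : iota (v j) != 0.
  apply/eqP => /(scalar_extension_eq0 phi_bij iotaP) vj0.
  (* A zero vector is 0 times 0, while primitivity allows only the factors 1 and -1. *)
  by have := v_prim j 0 0; rewrite scaler0 => /(_ vj0)[].
have v_free : free [tuple iota (v i) | i < d].
  rewrite sigmaE in dim_sigma Hrho.
  have eqd := cone_dim_cone_of X_free dim_sigma.
  (* [free_edge_points] indexes the edges like the generators, so [d] is replaced by [size X]. *)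
  clear Hmax dimV; subst d; apply: (free_edge_points X_free Hrho) => // i.
  by have [] := Hv i.
have dM : \det (\matrix_i phi (v i)) != 0.
  (* A left kernel vector [c] is an integer relation among the [v i]; [iota] carries it to a real
     relation, which freeness makes trivial. *)
  apply/det0P => -[c /eqP c0 cM]; apply: c0; apply/rowP => i; rewrite [RHS]mxE.
  have sum0 : \sum_i c 0 i *: v i = 0.
    apply: (bij_inj phi_bij); rewrite linear0 -[RHS]cM linear_sum mulmx_sum_row.
    by apply: eq_bigr => j _; rewrite linearZ /= rowK.
  have /freeP/(_ (fun i => (c 0 i)%:~R)) := v_free.
  under eq_bigr do rewrite nth_mktuple -additive_scale_int.
  rewrite -raddf_sum sum0 raddf0 => /(_ erefl i)/eqP.
  by rewrite intr_eq0 => /eqP.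
have [e [[e_basis /(alpha_hermite _ v_prim) e_alpha] e_uniq]] :=
  hermite_basis_exists_unique phi_bij dM.
exists e; split=> // e' [e'_basis /(alpha_hermite _ v_prim) e'_L].
exact: e_uniq.
Qed.
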